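(* Let $q\in\mathbb{C}$ with $q\neq1$ be such that $[n]_q\neq 0$ for all $n\geq 1$, let $u,\alpha\in\mathbb{C}$, let $(a_n^{(\alpha)})_{n\ge0}$ be complex numbers with $a_0^{(\alpha)}\neq0$ and $\mathcal{A}_q^{\alpha}(t)=\sum_{n\ge0}a_n^{(\alpha)}\frac{t^n}{[n]_q!}$, and let $\mathrm{P}_{n,q}^{(\alpha)}(x;u)$ be defined by $\mathcal{A}_q^{\alpha}(t)\mathrm{e}_q(tx,u)=\sum_{n}\mathrm{P}_{n,q}^{(\alpha)}(x;u)\frac{t^n}{[n]_q!}$. Define $\mathrm{Q}_{n,q}^{(\alpha)}(x,y,z;u)=\sum_{k=0}^{n}\genfrac{[}{]}{0pt}{}{n}{k}_{q}\mathrm{P}_{k,q}^{(\alpha)}(x;u)y^kz^{n-k}$. Then, as formal power series in $t$, $$\sum_{n=0}^{\infty}q^{\binom{n}{2}}\mathrm{Q}_{n,q}^{(\alpha)}(x,y,z;u)\frac{t^n}{[n]_q!}=\mathrm{E}_q(zt)\sum_{k=0}^{\infty}q^{\binom{k}{2}}\frac{\mathrm{P}_{k,q}^{(\alpha)}(x;u)}{(-(1-q)zt;q)_k\,[k]_q!}(ty)^k.$$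
   Context: $[n]_q=\frac{1-q^n}{1-q}$, $[n]_q!=[1]_q\cdots[n]_q$ ($[0]_q!=1$), $\genfrac{[}{]}{0pt}{}{n}{k}_{q}=\frac{[n]_q!}{[k]_q![n-k]_q!}$. $\mathrm{e}_q(z,u)=\sum_{n\ge0}u^{\binom{n}{2}}\frac{z^n}{[n]_q!}$ (convention $0^0=1$), and $\mathrm{E}_q(z)=\mathrm{e}_q(z,q)=\sum_{n\ge0}q^{\binom{n}{2}}\frac{z^n}{[n]_q!}$. The $q$-shifted factorial is $(a;q)_0=1$, $(a;q)_k=\prod_{j=0}^{k-1}(1-q^ja)$. *)

(* Defs.v *)
From HB Require Import structures.
From mathcomp Require Import all_boot all_order all_algebra.
From mathcomp Require Import boolp reals.
From mathcomp Require Import complex.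

Set Implicit Arguments.
Unset Strict Implicit.
Unset Printing Implicit Defensive.

Import GRing.Theory.
Local Open Scope ring_scope.

(* Formal power series in one variable t: [f n] is the coefficient of t^n.
   They form a commutative unit algebra, in which [f^-1] is the inverse series
   as soon as [f 0%N != 0]. *)
Record fps (K : Type) := FPS { fcoef :> nat -> K }.

Lemma fpsP (K : Type) (f g : fps K) : f =1 g <-> f = g.
Proof.
split=> [|-> //]; case: f => f; case: g => g /= fg.
by congr FPS; apply/funext.
Qed.

HB.instance Definition _ (K : Type) := gen_eqMixin (fps K).
HB.instance Definition _ (K : Type) := gen_choiceMixin (fps K).

Section FpsRing.
Variable K : fieldType.
Implicit Types f g h : fps K.

Definition fps_zero : fps K := FPS (fun=> 0).
Definition fps_opp f : fps K := FPS (fun n => - f n).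
Definition fps_add f g : fps K := FPS (fun n => f n + g n).

Fact fps_addA : associative fps_add.
Proof. by move=> f g h; apply/fpsP => n /=; rewrite addrA. Qed.
Fact fps_addC : commutative fps_add.
Proof. by move=> f g; apply/fpsP => n /=; rewrite addrC. Qed.
Fact fps_add0 : left_id fps_zero fps_add.
Proof. by move=> f; apply/fpsP => n /=; rewrite add0r. Qed.
Fact fps_addN : left_inverse fps_zero fps_opp fps_add.
Proof. by move=> f; apply/fpsP => n /=; rewrite addNr. Qed.

HB.instance Definition _ :=
  GRing.isZmodule.Build (fps K) fps_addA fps_addC fps_add0 fps_addN.

Definition fps_const (c : K) : fps K := FPS (fun n => if n == 0%N then c else 0).
Definition fps_mul f g : fps K :=
  FPS (fun n => \sum_(i < n.+1) f i * g (n - i)%N).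

Let tr n f : {poly K} := \poly_(i < n.+1) f i.

Let fps_mulE n m f g : (n <= m)%N -> fps_mul f g n = (tr m f * tr m g)`_n.
Proof.
move=> nm; rewrite coefM /=; apply: eq_bigr => i _.
by rewrite !coef_poly !ltnS (leq_trans (leq_subr _ _) nm)
           (leq_trans _ nm) // -ltnS.
Qed.

Fact fps_mulA : associative fps_mul.
Proof.
move=> f g h; apply/fpsP => n.
transitivity ((tr n f * (tr n g * tr n h))`_n).
  rewrite coefM; apply: eq_bigr => i _; rewrite coef_poly ltn_ord.
  by rewrite -(fps_mulE _ _ (leq_subr i n)).
rewrite mulrA coefM; apply: eq_bigr => i _.
by rewrite -(fps_mulE _ _ (ltn_ord i : (i <= n)%N)) coef_poly ltnS leq_subr.
Qed.

Fact fps_mulC : commutative fps_mul.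
Proof. by move=> f g; apply/fpsP => n; rewrite !(@fps_mulE n n) // mulrC. Qed.

Fact fps_constM c f n : fps_mul (fps_const c) f n = c * f n.
Proof.
by rewrite /= big_ord_recl /= subn0 big1 ?addr0 // => i _; rewrite mul0r.
Qed.

Fact fps_mul1 : left_id (fps_const 1) fps_mul.
Proof. by move=> f; apply/fpsP => n; rewrite fps_constM mul1r. Qed.

Fact fps_mulDl : left_distributive fps_mul fps_add.
Proof.
move=> f g h; apply/fpsP => n /=; rewrite -big_split; apply: eq_bigr => i _ /=.
by rewrite mulrDl.
Qed.

Fact fps_one_neq0 : fps_const 1 != 0.
Proof. by apply/eqP => /fpsP/(_ 0%N)/= /eqP; rewrite oner_eq0. Qed.

HB.instance Definition _ := GRing.Zmodule_isComNzRing.Build (fps K)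
  fps_mulA fps_mulC fps_mul1 fps_mulDl fps_one_neq0.

Definition fps_scale (c : K) f : fps K := FPS (fun n => c * f n).

Fact fps_scaleA a b f : fps_scale a (fps_scale b f) = fps_scale (a * b) f.
Proof. by apply/fpsP => n /=; rewrite mulrA. Qed.
Fact fps_scale1 : left_id 1 fps_scale.
Proof. by move=> f; apply/fpsP => n /=; rewrite mul1r. Qed.
Fact fps_scaleDr : right_distributive fps_scale +%R.
Proof. by move=> c f g; apply/fpsP => n; apply: mulrDr. Qed.
Fact fps_scaleDl f : {morph fps_scale^~ f : a b / a + b}.
Proof. by move=> a b; apply/fpsP => n; apply: mulrDl. Qed.

HB.instance Definition _ := GRing.Zmodule_isLmodule.Build K (fps K)
  fps_scaleA fps_scale1 fps_scaleDr fps_scaleDl.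

Fact fps_scaleAl (a : K) f g : a *: (f * g) = a *: f * g.
Proof.
by apply/fpsP => n; rewrite /= mulr_sumr; apply: eq_bigr => i _; rewrite mulrA.
Qed.

HB.instance Definition _ :=
  GRing.Lmodule_isLalgebra.Build K (fps K) fps_scaleAl.
HB.instance Definition _ :=
  GRing.Lalgebra_isComAlgebra.Build K (fps K).

(* The first n coefficients of 1 / f. *)
Fixpoint fps_inv_seq f n : seq K :=
  if n is m.+1 then
    let s := fps_inv_seq f m in
    rcons s ((f 0%N)^-1 *
             ((m == 0%N)%:R - \sum_(i < m) f (m - i)%N * s`_i))
  else [::].

Definition fps_unit : {pred fps K} := [pred f | fcoef f 0%N != 0].

(* The inverse of a non-unit is itself, following the library convention. *)
Definition fps_inv f : fps K :=
  if f \in fps_unit then FPS (fun n => (fps_inv_seq f n.+1)`_n) else f.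

Let size_inv_seq f n : size (fps_inv_seq f n) = n.
Proof. by elim: n => //= n IH; rewrite size_rcons IH. Qed.

Let nth_inv_seq f n i : (i < n)%N ->
  (fps_inv_seq f n)`_i = (fps_inv_seq f i.+1)`_i.
Proof.
elim: n => // n IH; rewrite ltnS leq_eqVlt => /orP[/eqP-> //|lt_in].
by rewrite [LHS]/= nth_rcons size_inv_seq lt_in IH.
Qed.

Fact fps_mulVr : {in fps_unit, left_inverse 1 fps_inv *%R}.
Proof.
move=> f uf; have f0 : f 0%N != 0 := uf.
apply/fpsP => n; rewrite /fps_inv uf.
set s := fun n => _; change (\sum_(i < n.+1) s i * f (n - i)%N
  = if n == 0%N then 1 else 0).
rewrite big_ord_recr /= subnn.
have -> : s n = (f 0%N)^-1 * ((n == 0%N)%:R - \sum_(i < n) f (n - i)%N * s i).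
  rewrite /s /= nth_rcons size_inv_seq ltnn eqxx; congr (_ * (_ - _)).
  by apply: eq_bigr => i _; rewrite nth_inv_seq.
rewrite mulrC mulVKf //.
rewrite (eq_bigr (fun i : 'I_n => f (n - i)%N * s i)); last by move=> i _; rewrite mulrC.
by rewrite addrC subrK; case: eqP.
Qed.

Fact fps_unitP f g : g * f = 1 -> f \in fps_unit.
Proof.
move=> /fpsP/(_ 0%N); rewrite /= big_ord1 /= => gf1.
rewrite /fps_unit inE; apply/eqP => f0.
by move/eqP: gf1; rewrite f0 mulr0 eq_sym oner_eq0.
Qed.

Fact fps_inv_out : {in [predC fps_unit], fps_inv =1 id}.
Proof. by move=> f /negbTE nf; rewrite /fps_inv nf. Qed.

HB.instance Definition _ := GRing.ComNzRing_hasMulInverse.Build (fps K)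
  fps_mulVr fps_unitP fps_inv_out.

Definition fpsT : fps K := FPS (fun n => (n == 1%N)%:R).

Definition fps_dilate (c : K) f : fps K := FPS (fun n => c ^+ n * f n).

(* Convergence of a series of power series in the t-adic topology: every
   coefficient of the partial sums is eventually constant. *)
Definition fps_is_sum (F : nat -> fps K) (s : fps K) : Prop :=
  forall n, exists N, forall m, (N <= m)%N -> (\sum_(k < m) F k) n = s n.

Lemma fps_sum_unique F s1 s2 : fps_is_sum F s1 -> fps_is_sum F s2 -> s1 = s2.
Proof.
move=> F1 F2; apply/fpsP => n; have [N1 P1] := F1 n; have [N2 P2] := F2 n.
by rewrite -(P1 _ (leq_maxl N1 N2)) P2 // leq_maxr.
Qed.

Lemma coef_fpsTn k n : (fpsT ^+ k : fps K) n = (n == k)%:R.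
Proof.
elim: k n => [|k IH] n; first by rewrite expr0 /=; case: eqP.
rewrite exprS; change (\sum_(i < n.+1) fpsT i * (fpsT ^+ k : fps K) (n - i)%N
  = (n == k.+1)%:R).
case: n => [|n]; first by rewrite big_ord1 /= mul0r.
rewrite 2!big_ord_recl big1 ?addr0 => [|i _]; last by rewrite /= mul0r.
by rewrite /= mul0r add0r mul1r subSS subn0 IH eqSS.
Qed.

Lemma fps_is_sum_coef f : fps_is_sum (fun n => f n *: fpsT ^+ n) f.
Proof.
move=> n; exists n.+1 => m lt_nm.
have cS (F : nat -> fps K) p : (\sum_(k < p) F k) n = \sum_(k < p) F k n.
  by elim: p => [|p IH]; rewrite ?big_ord0 // !big_ord_recr -IH.
rewrite (cS (fun k => f k *: fpsT ^+ k)) (bigD1 (Ordinal lt_nm)) //=.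
rewrite big1 ?addr0 => [|i /eqP ne_in].
  by change (f n * (fpsT ^+ n : fps K) n = f n); rewrite coef_fpsTn eqxx mulr1.
change (f i * (fpsT ^+ i : fps K) n = 0); rewrite coef_fpsTn.
case: eqP => [e|]; last by rewrite mulr0.
by case: ne_in; apply: val_inj.
Qed.

End FpsRing.

Notation "''t'" := (fpsT _) (at level 0) : ring_scope.

Section QCalculus.
Variables (K : fieldType) (q : K).

Definition qint n : K := (1 - q ^+ n) / (1 - q).
Definition qfact n : K := \prod_(1 <= i < n.+1) qint i.
Definition qbinom n k : K := qfact n / (qfact k * qfact (n - k)).

Definition qpoch (A : algType K) (a : A) k : A :=
  \prod_(j < k) (1 - q ^+ j *: a).

(* The series \sum_n c_n t^n / [n]_q!. *)
Definition qgen (c : nat -> K) : fps K := FPS (fun n => c n / qfact n).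

(* e_q(t, u) and E_q(t); here 0 ^+ 0 = 1, and e_q(ct, u) is
   [fps_dilate c (qexp u)]. *)
Definition qexp (u : K) : fps K := qgen (fun n => u ^+ 'C(n, 2)).
Definition qExp : fps K := qexp q.

Definition homog_qsum (p : nat -> K) (y z : K) n : K :=
  \sum_(k < n.+1) qbinom n k * p k * y ^+ k * z ^+ (n - k).

End QCalculus.

(* Main.v *)
(** The series E_q satisfies E_q(z) = (1 + (1-q)z) E_q(qz), hence
    E_q(zt) = (-(1-q)zt; q)_k E_q(q^k zt).  Each summand of the right-hand side
    times E_q(zt) is therefore a multiple of t^k E_q(q^k zt), and the
    coefficients match since C(n,2) = C(k,2) + C(n-k,2) + k(n-k). *)
Require Import Defs.
From mathcomp Require Import all_boot all_order all_algebra.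
From mathcomp Require Import reals complex.
From mathcomp Require Import ring zify.

Import GRing.Theory.
Local Open Scope ring_scope.

(** Pairs in a union of two blocks of sizes [k] and [m] lie inside one block or cross between the
    two. *)
Lemma bin2D (k m : nat) : 'C(k + m, 2) = ('C(k, 2) + 'C(m, 2) + k * m)%N.
Proof.
elim: k => [|k IH]; first by rewrite bin0n mul0n addn0.
by rewrite addSn !binS !bin1 IH; lia.
Qed.

Section FormalPowerSeries.
Variable K : fieldType.
Implicit Types (f g s : fps K) (F : nat -> fps K).

Lemma fcoefD f g n : (f + g) n = f n + g n.
Proof. by []. Qed.

Lemma fcoefZ (c : K) f n : (c *: f) n = c * f n.
Proof. by []. Qed.

Lemma fcoefM f g n : (f * g) n = \sum_(i < n.+1) f i * g (n - i)%N.
Proof. by []. Qed.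

Lemma fcoef_sum (I : finType) (G : I -> fps K) n :
  (\sum_i G i) n = \sum_i G i n.
Proof. exact: (big_morph (fun f : fps K => f n)). Qed.

Lemma fcoef_fpsTnM k f n :
  ('t ^+ k * f) n = if (k <= n)%N then f (n - k)%N else 0.
Proof.
rewrite fcoefM; case: leqP => [le_kn | lt_nk].
  have lt_kn : (k < n.+1)%N by [].
  rewrite (bigD1 (Ordinal lt_kn)) //= coef_fpsTn eqxx mul1r big1 ?addr0 // => i ne_ik.
  by rewrite coef_fpsTn -[(_ == k)]/(i == Ordinal lt_kn) (negbTE ne_ik) mul0r.
rewrite big1 // => i _; rewrite coef_fpsTn ltn_eqF ?mul0r //.
exact: leq_trans (ltn_ord i) lt_nk.
Qed.

Lemma fps_unitE f : (f \is a GRing.unit) = (f 0%N != 0).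
Proof. by []. Qed.

(** Coefficient [n] of a product involves only coefficients 0 to [n] of each factor, so the maximum
    of finitely many thresholds serves for the product. *)
Lemma fps_is_sumMl g F s :
  fps_is_sum F s -> fps_is_sum (fun k => g * F k) (g * s).
Proof.
move=> Fs n; have /fin_all_exists[N PN] (i : 'I_n.+1) := Fs (n - i)%N.
exists (\max_i N i)%N => m le_Nm; rewrite -mulr_sumr !fcoefM.
apply: eq_bigr => i _; rewrite PN //.
exact: leq_trans (leq_bigmax i) le_Nm.
Qed.

End FormalPowerSeries.

Section QExponential.
Variables (K : fieldType) (q : K).

(** Every factor has constant coefficient 1. Hence the inverses in the theorem are genuine, not the
    default value of [^-1]. *)
Lemma qpoch_unit (c : K) k : qpoch q (c *: ('t : fps K)) k \is a GRing.unit.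
Proof.
rewrite /qpoch; elim/big_rec: _ => [|j f _ uf]; first exact: unitr1.
rewrite unitrM uf andbT fps_unitE.
rewrite fcoefD -scaleN1r !fcoefZ /= !mulr0 addr0; exact: oner_neq0.
Qed.

Hypothesis (hq1 : q != 1) (hq : forall n : nat, (1 <= n)%N -> qint q n != 0).

Lemma qfactS n : qfact q n.+1 = qfact q n * qint q n.+1.
Proof. by rewrite /qfact big_nat_recr. Qed.

Lemma qfact_neq0 n : qfact q n != 0.
Proof.
elim: n => [|n IH]; first by rewrite /qfact big_geq ?oner_neq0.
by rewrite qfactS mulf_neq0 ?hq.
Qed.

(** At t^(n+1) the identity amounts to C(n+1,2) = C(n,2) + n and (1-q)[n+1]_q = 1 - q^(n+1). *)
Lemma qExp_dilate (c : K) :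
  fps_dilate c (qExp q) =
  (1 + ((1 - q) * c) *: 't) * fps_dilate (c * q) (qExp q).
Proof.
apply/fpsP => n.
rewrite mulrDl mul1r -scalerAl fcoefD fcoefZ -['t]expr1 fcoef_fpsTnM /=.
case: n => [|n] /=; first by rewrite !expr0 mulr0 addr0.
rewrite subSS subn0 binS bin1 qfactS.
have q1 : 1 - q != 0 by rewrite subr_eq0 eq_sym.
have /= f0 := qfact_neq0 n; have := hq n.+1 isT; rewrite /qint => i0.
(* With [qint] unfolded, this numerator of [n+1]_q occurs as a divisor, so [field] needs it to be
   nonzero. *)
have p0 : 1 - q ^+ n.+1 != 0.
  by apply: contraNneq i0 => ->; rewrite mul0r.
move: p0; rewrite !exprMn !exprD !exprS => p0; field.
by rewrite f0 q1 p0.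
Qed.

Lemma qExp_qpoch (c : K) k :
  fps_dilate c (qExp q) =
  qpoch q (- ((1 - q) * c) *: 't) k * fps_dilate (c * q ^+ k) (qExp q).
Proof.
elim: k => [|k IH]; first by rewrite /qpoch big_ord0 mul1r expr0 mulr1.
rewrite IH qExp_dilate /qpoch big_ord_recr /= mulrA; congr (_ * _ * _).
  by rewrite scaleNr scalerN opprK scalerA; congr (_ + _ *: _); ring.
by rewrite exprSr mulrA.
Qed.

Lemma qExp_summand (c d y : K) k :
  fps_dilate c (qExp q) *
    (d *: ((qfact q k *: qpoch q (- ((1 - q) * c) *: 't) k)^-1
           * (y *: 't) ^+ k))
  = (d * (qfact q k)^-1 * y ^+ k) *:
      ('t ^+ k * fps_dilate (c * q ^+ k) (qExp q)).
Proof.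
have up := qpoch_unit (- ((1 - q) * c)) k.
rewrite (qExp_qpoch c k) invrZ ?unitfE ?qfact_neq0 // exprZn.
rewrite -scalerAl -!scalerAr !scalerA; congr (_ *: _).
by rewrite mulrAC !mulrA mulrV // mul1r mulrC.
Qed.

(** The factor [n]_q! of the q-binomial cancels, and the cross term k(n-k) of the exponent becomes
    the dilation by q^k, read at degree n-k. *)
Lemma homog_qsum_coef (p : nat -> K) (y z : K) n :
  q ^+ 'C(n, 2) * homog_qsum q p y z n / qfact q n =
  \sum_(k < n.+1) q ^+ 'C(k, 2) * p k * (qfact q k)^-1 * y ^+ k
     * fps_dilate (z * q ^+ k) (qExp q) (n - k)%N.
Proof.
rewrite /homog_qsum mulr_sumr mulr_suml; apply: eq_bigr => k _ /=.
have le_kn : (k <= n)%N by rewrite -ltnS.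
have -> : 'C(n, 2) = ('C(k, 2) + 'C(n - k, 2) + k * (n - k))%N.
  by rewrite -bin2D subnKC.
rewrite /qbinom !exprD exprMn -exprM.
have f0 := qfact_neq0; field; by rewrite !f0.
Qed.

Lemma qgen_homog_qsum (p : nat -> K) (y z : K) :
  fps_is_sum
    (fun k => fps_dilate z (qExp q) *
       ((q ^+ 'C(k, 2) * p k) *:
          ((qfact q k *: qpoch q (- ((1 - q) * z) *: 't) k)^-1
           * (y *: 't) ^+ k)))
    (qgen q (fun n => q ^+ 'C(n, 2) * homog_qsum q p y z n)).
Proof.
(* Summand [k] is a multiple of t^k, so those with k > n do not affect coefficient [n]. *)
move=> n; exists n.+1 => m lt_nm.
rewrite [RHS]homog_qsum_coef fcoef_sum.
pose G k := q ^+ 'C(k, 2) * p k / qfact q k * y ^+ k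
  * fps_dilate (z * q ^+ k) (qExp q) (n - k)%N.
(* Extending the range to k < m under the guard k <= n matches the case split in the coefficient of
   t^k times a series. *)
rewrite (big_ord_widen _ G lt_nm) /G.
rewrite [RHS]big_mkcond; apply: eq_bigr => k _.
by rewrite qExp_summand fcoefZ fcoef_fpsTnM ltnS; case: leqP; rewrite ?mulr0.
Qed.

(** The constant coefficient is 1/[0]_q! = 1. *)
Lemma qExp_unit (c : K) : fps_dilate c (qExp q) \is a GRing.unit.
Proof.
by rewrite fps_unitE /= !expr0 !mul1r invr_eq0 qfact_neq0.
Qed.

End QExponential.

Theorem theorem15 (R : realType) (q u alpha : R[i])
    (a : R[i] -> nat -> R[i]) (P : nat -> R[i] -> R[i] -> R[i] -> R[i])
    (hq1 : q != 1) (hq : forall n : nat, (1 <= n)%N -> qint q n != 0)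
    (ha : a alpha 0%N != 0)
    (hP : forall x : R[i],
       qgen q (a alpha) * fps_dilate x (qexp q u)
       = qgen q (fun n => P n alpha x u))
    (x y z : R[i]) :
  exists S : fps R[i],
    fps_is_sum
      (fun k => (q ^+ 'C(k, 2) * P k alpha x u) *:
         ((qfact q k *: qpoch q (- ((1 - q) * z) *: 't) k)^-1 * (y *: 't) ^+ k))
      S
    /\ qgen q (fun n => q ^+ 'C(n, 2)
                        * homog_qsum q (fun k => P k alpha x u) y z n)
       = fps_dilate z (qExp q) * S.
Proof.
have uE := qExp_unit _ _ hq z.
(* The required identity forces this witness, since E_q(zt) is invertible. Convergence follows by
   multiplying the series for [L] termwise by the inverse of E_q(zt). *)
set L := qgen q _; exists ((fps_dilate z (qExp q))^-1 * L).
split; last by rewrite mulVKr.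
have /(fps_is_sumMl _ (fps_dilate z (qExp q))^-1) sumL :=
  qgen_homog_qsum _ _ hq1 hq (fun k => P k alpha x u) y z.
move=> n; have [N PN] := sumL n; exists N => m /PN <-.
by congr (fcoef _ n); apply: eq_bigr => k _; rewrite mulKr.
Qed.
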